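(* Let $k$, $n$, $t$ be non-negative integers with $0\le t\le k-1$ and $n\ge 1$. For each $1\le i\le k$ let $a_i$ be a non-negative integer, with $a_1+\cdots+a_k=n$. Then the number of $k_t$-Dyck paths of length $(k+1)n$ with exactly $a_i$ down-steps at a height of $i$ modulo $k$ for each $1\le i\le k$ is \[ \big|\mathcal{K}_{k,t}^{n}(a_1,\ldots,a_k)\big| = \frac{a_{k-t}+\cdots+a_k}{n(n+1)}\prod_{i=k-t}^{k}\binom{n+a_i}{a_i}\prod_{i=1}^{k-t-1}\binom{n+a_i-1}{a_i}. \]
   Context: For non-negative integers $k,t,n$ with $0\le t<k$, a $k_t$-Dyck path of length $(k+1)n$ is a lattice path consisting of $n$ down-steps $(1,-k)$ and $kn$ up-steps $(1,1)$ that starts at $(0,0)$, ends at $((k+1)n,0)$, and stays weakly above the line $y=-t$. A down-step is said to be at a height of $i$ modulo $k$ if its endpoint has $y$-coordinate congruent to $i$ modulo $k$. $\mathcal{K}_{k,t}^{n}(a_1,\ldots,a_k)$ denotes the set of $k_t$-Dyck paths of length $(k+1)n$ having, for each $1\le i\le k$, exactly $a_i$ down-steps at a height of $i$ modulo $k$. *)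

(* Defs.v *)
From mathcomp Require Import all_boot all_order all_algebra.

Set Implicit Arguments.
Unset Strict Implicit.
Unset Printing Implicit Defensive.

Import Order.TTheory GRing.Theory Num.Theory.
Local Open Scope ring_scope.

(* A path is encoded by its word of steps: [true] is the up-step (1, 1),
   [false] is the down-step (1, -k). *)
Definition rise (k : nat) (b : bool) : int := if b then 1 else - k%:Z.

(* The vertices of the path are the points (j, height k s j), 0 <= j <= size s;
   ordinates may be negative, hence the values in [int]. *)
Definition height (k : nat) (s : seq bool) (j : nat) : int :=
  \sum_(b <- take j s) rise k b.

(* It is enough to test the vertices for staying weakly above y = -t, since the
   path is linear between consecutive vertices. *)
Definition kt_dyck (k t n : nat) (p : (k.+1 * n).-tuple bool) : bool :=
  [&& count_mem false p == n,
      count_mem true p == (k * n)%N,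
      height k p (k.+1 * n) == 0
    & [forall j : 'I_(k.+1 * n).+1, - t%:Z <= height k p j]].

(* Step number j goes from vertex j to vertex j.+1. *)
Definition down_steps_at (k n : nat) (p : (k.+1 * n).-tuple bool) (i : nat) :
    {set 'I_(k.+1 * n)} :=
  [set j | ~~ tnth p j & (height k p j.+1 == i %[mod k])%Z].

(* Only the values a 1, ..., a k of [a] are used. *)
Definition kt_dyck_paths (k t n : nat) (a : nat -> nat) :
    {set (k.+1 * n).-tuple bool} :=
  [set p | kt_dyck t p
         & [forall i : 'I_k, #|down_steps_at p i.+1| == a i.+1]].

(* Main.v *)
(* If a down-step is preceded by u up-steps, write u + t = k q + r with
   0 <= r < k: its residue class depends on r only, and staying above y = -t
   says that for every m < n at most m down-steps have q <= m. A path is thus a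
   family of rows indexed by r, each a weak composition into slots q = 0, ..., n,
   where the slot q = n must stay empty when r > t, subject to this ballot
   condition. Without it the families are counted by the product of binomials.
   For a fixed content of the slot n, of size j say, the cycle lemma says that
   exactly j of the n rotations of the remaining slots satisfy the condition, so
   n times the number of paths is the total content of the slot n over all
   families. In the rows r <= t the slot n is exchangeable with each of the
   n + 1 slots, hence this total is (a_{k-t} + ... + a_k) / (n + 1) times the
   number of families. *)
Require Import Defs.
From mathcomp Require Import all_boot all_order all_fingroup all_algebra.
From mathcomp Require Import zify ring.

Set Implicit Arguments.
Unset Strict Implicit.
Unset Printing Implicit Defensive.

Import Order.TTheory GRing.Theory Num.Theory.
Local Open Scope ring_scope.

(** * Weak compositions counted by generating polynomials *)

Lemma sum_bin_diag m c : (\sum_(i < c.+1) 'C(m + i - 1, i) = 'C(m + c, c))%N.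
Proof.
elim: c => [|c IH]; first by rewrite big_ord_recl big_ord0 !bin0.
by rewrite big_ord_recr /= IH !addnS subn1 /= binS addnC.
Qed.

Lemma coef_geometric_exp b m c : (c <= b)%N ->
  ((\poly_(j < b.+1) 1 : {poly int}) ^+ m)`_c = ('C(m + c - 1, c))%:R.
Proof.
elim: m c => [|m IH] c hc.
  by rewrite expr0 coef1 add0n; case: c {hc} => [|c] //=; rewrite subn1 /= bin_small.
rewrite exprSr coefM.
under eq_bigr => i _.
  have hi : (i <= c)%N by rewrite -ltnS.
  rewrite IH ?(leq_trans hi) // coef_poly ltnS (leq_trans (leq_subr _ _) hc) mulr1.
  over.
by rewrite -natr_sum sum_bin_diag addSn subn1.
Qed.

(** Expanding the product over [s] of the sums of allowed powers of X gives one monomial per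
    function, whose degree is its total. As [c <= b], the bound on the values excludes no
    composition. *)
Lemma card_bounded_compositions (S : finType) (T : {set S}) b c : (c <= b)%N ->
  #|[set f : {ffun S -> 'I_b.+1} |
      [forall s, (s \in T) || (f s == ord0)] & (\sum_s f s == c)%N]|
  = 'C(#|T| + c - 1, c).
Proof.
move=> hc; apply/eqP; rewrite -(eqr_nat int) -(coef_geometric_exp _ hc); apply/eqP.
pose G s (j : 'I_b.+1) : {poly int} := if (s \in T) || (j == ord0) then 'X^j else 0.
have -> : ((\poly_(j < b.+1) 1 : {poly int}) ^+ #|T|) = \prod_s \sum_j G s j.
  rewrite -prodr_const big_mkcond; apply: eq_bigr => s _; case: ifP => sT; last first.
    rewrite (bigD1 ord0) //= big1 ?addr0 /G ?sT ?eqxx ?orbT //.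
    by move=> j /negPf ->.
  by rewrite poly_def; apply: eq_bigr => j _; rewrite /G sT scale1r.
rewrite bigA_distr_bigA coef_sum -sum1_card natr_sum big_mkcond /=.
apply: eq_bigr => f _; rewrite !inE.
case: forallP => /= [hf|hf].
  have GE s : G s (f s) = 'X^(f s) by rewrite /G (hf s).
  by rewrite (eq_bigr _ (fun s _ => GE s)) prodrXr coefXn eq_sym; case: eqP.
have /existsP[s hs] : [exists s, ~~ ((s \in T) || (f s == ord0))].
  by rewrite -negb_forall; apply/negP => /forallP.
by rewrite (bigD1 s) //= /G (negPf hs) mul0r coef0.
Qed.

(** * Last passages and the cycle lemma *)

Fixpoint window_min (g : nat -> int) (s l : nat) : int :=
  if l is l'.+1 then Num.min (g s) (window_min g s.+1 l') else g s.

Lemma window_minSr g s l :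
  window_min g s l.+1 = Num.min (window_min g s l) (g (s + l.+1)%N).
Proof.
elim: l s => [|l IH] s; first by rewrite /= addn1.
by rewrite -[LHS]/(Num.min _ (window_min g s.+1 l.+1)) IH /= minA addSnnS.
Qed.

Lemma window_min_le g s l : window_min g s l <= g s.
Proof. by case: l => //= l; rewrite ge_min lexx. Qed.

Lemma window_min_shift g n j s l : (forall m, g (m + n)%N = g m + j) ->
  window_min g (s + n) l = window_min g s l + j.
Proof.
move=> gD; elim: l s => [|l IH] s /=; first exact: gD.
by rewrite -addSn IH gD -addr_minl.
Qed.

Lemma lt_window_min x g s l :
  (x < window_min g s l) = [forall m : 'I_l.+1, x < g (s + m)%N].
Proof.
elim: l s => [|l IH] s /=.
  apply/idP/forallP => [h m|/(_ ord0)]; last by rewrite addn0.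
  by rewrite ord1 addn0.
rewrite lt_min IH; apply/andP/forallP => [[h0 /forallP h] m|h].
  by case: (unliftP ord0 m) => [m'|] ->; rewrite ?addn0 // lift0 -addSnnS.
split; first by have := h ord0; rewrite addn0.
by apply/forallP => m; have := h (lift ord0 m); rewrite lift0 addSnnS.
Qed.

(* The minimum h s of g over [s, +oo[ (attained in a window of length n.+1, since
   g gains j >= 0 over such a window) increases by 1 exactly when s is a last
   passage and is constant otherwise, so the count telescopes to h n.+1 - h 0. *)
Lemma count_last_passages (g : nat -> int) n (j : nat) :
  (forall m, g m.+1 <= g m + 1) -> (forall m, g (m + n.+1)%N = g m + j%:Z) ->
  (\sum_(s < n.+1) [forall m : 'I_n.+1, (g s < g (s + m.+1)%N)%R])%N = j.
Proof.
move=> gS gD; pose h s := window_min g s n.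
have hmin s : h s = Num.min (g s) (h s.+1).
  rewrite -[RHS]/(window_min g s n.+1) window_minSr gD /h min_l //.
  by rewrite (le_trans (window_min_le _ _ _)) // lerDl.
have hS s : ([forall m : 'I_n.+1, g s < g (s + m.+1)%N])%:R = h s.+1 - h s.
  have -> : [forall m : 'I_n.+1, g s < g (s + m.+1)%N] = (g s < h s.+1).
    by rewrite lt_window_min; apply: eq_forallb => m; rewrite addSnnS.
  (* If [g s < h s.+1], then [h s.+1 <= g s.+1 <= g s + 1] forces a jump of exactly 1. *)
  have := window_min_le g s.+1 n; rewrite -/(h _) => h1.
  by rewrite (hmin s); have := gS s; case: ltP => h2 h3 /=; lia.
apply/eqP; rewrite -(eqr_nat int) natr_sum; apply/eqP.
under eq_bigr do rewrite hS.
rewrite -(big_mkord predT (fun s => h s.+1 - h s)) telescope_sumr //.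
by rewrite -[n.+1]add0n /h (window_min_shift _ _ gD) // [_ + j%:Z]addrC addrK; lia.
Qed.

(** Let [g m] be [m] minus the sum of the first [m] terms of the periodic extension of [b]. The
    rotation by [s] passes the test exactly when [g] stays strictly above [g s] over the next
    period, and such last passages number the gain [j] of [g] per period. *)
Lemma cycle_lemma n (b : 'I_n.+1 -> nat) j :
  (\sum_i b i + j = n.+1)%N ->
  (\sum_(s < n.+1) [forall m : 'I_n.+1,
      \sum_(i < n.+1 | i <= m) b (i + s)%R <= m])%N = j.
Proof.
move=> bj; pose B i := b (inord (i %% n.+1)).
have bB (i : 'I_n.+1) : b i = B i by rewrite /B modn_small // inord_val.
pose g m : int := m%:Z - (\sum_(i < m) B i)%N%:Z.
have sumD m p : (\sum_(i < m + p) B i = \sum_(i < m) B i + \sum_(i < p) B (i + m))%N.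
  by rewrite big_split_ord /=; congr addn; apply: eq_bigr => i _; rewrite addnC.
rewrite -[RHS](@count_last_passages g n j).
- apply: eq_bigr => s _; congr nat_of_bool; apply: eq_forallb => m.
  rewrite /g sumD.
  suff -> : (\sum_(i < n.+1 | i <= m) b (i + s)%R = \sum_(i < m.+1) B (i + s))%N by lia.
  rewrite (big_ord_widen n.+1 (fun i => B (i + s)%N) (ltn_ord m)).
  apply: eq_big => [i|i _]; first by rewrite ltnS.
  by congr b; apply: val_inj; rewrite /= inordK ?ltn_pmod.
- by move=> m; rewrite /g big_ord_recr /=; lia.
- move=> m; rewrite /g addnC sumD.
  have -> : (\sum_(i < n.+1) B i = \sum_i b i)%N by apply: eq_bigr => i _; rewrite bB.
  have -> : (\sum_(i < m) B (i + n.+1) = \sum_(i < m) B i)%N.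
    by apply: eq_bigr => i _; rewrite /B modnDr.
  lia.
Qed.

(** * Configurations, their rotations and slot exchanges *)

Lemma sum_option (T : finType) (F : option T -> nat) :
  (\sum_x F x = F None + \sum_i F (Some i))%N.
Proof.
rewrite (bigD1 None) //=; congr addn.
rewrite (reindex_omap Some id) /= => [|[]//].
by apply: eq_bigl => i; rewrite eqxx.
Qed.

(* The slot [None] stands for q = n, the slot [Some i] for q = i. *)
Notation config k n := {ffun 'I_k -> {ffun option 'I_n -> 'I_n.+1}}.

(** [P] marks the rows whose last slot may be filled. Entries bounded by [n] keep the type finite,
    at no loss once [c r <= n]. *)
Definition configs (k n : nat) (P : pred 'I_k) (c : 'I_k -> nat) :
    {set config k n} :=
  [set w : config k n | [forall r, (P r || (w r None == ord0)) && (\sum_x w r x == c r)%N]].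

Arguments configs {k n}.

Definition ballot (k n : nat) (w : config k n) : bool :=
  [forall m : 'I_n, (\sum_(i < n | i <= m) \sum_r w r (Some i) <= m)%N].

Lemma configsP k n (P : pred 'I_k) c (w : config k n) :
  reflect (forall r, (P r || (w r None == ord0)) /\ (\sum_x w r x = c r)%N)
          (w \in configs P c).
Proof.
rewrite inE; apply: (iffP forallP) => h r; have := h r.
  by case/andP=> -> /eqP ->.
by case=> -> ->; rewrite eqxx.
Qed.

Lemma card_configs k n (P : pred 'I_k) c : (forall r, c r <= n)%N ->
  #|configs (n := n) P c| = (\prod_r 'C(n + P r + c r - 1, c r))%N.
Proof.
move=> hc; pose F r := [set f : {ffun option 'I_n -> 'I_n.+1} |
  [forall x, (x \in [set x | P r || (x != None)]) || (f x == ord0)]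
  & (\sum_x f x == c r)%N].
have -> : #|configs (n := n) P c| = #|family F|.
  apply: eq_card => w; apply/configsP/familyP => h r; have := h r.
    case=> hN hS; rewrite inE hS eqxx andbT; apply/forallP => x; rewrite inE.
    by case: x => [x|]; rewrite ?orbT ?orbF.
  by rewrite inE => /andP[/forallP/(_ None)]; rewrite inE orbF => -> /eqP.
rewrite card_family foldrE big_image /=; apply: eq_bigr => r _.
rewrite card_bounded_compositions //; congr 'C(_ + _ - 1, _).
have [Pr|Pr] := boolP (P r).
  by rewrite eq_cardT -?cardT ?card_option ?card_ord ?addn1 // => x; rewrite !inE.
have -> : [set x : option 'I_n | false || (x != None)] = [set~ None].
  by apply/setP => x; rewrite !inE.
by rewrite cardsC1 card_option card_ord addn0.
Qed.

(** [omap] fixes the slot [None]; the size [n.+1] makes the other slots the cyclic group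
    ['I_n.+1]. *)
Definition rotate_config k n (s : 'I_n.+1) (w : config k n.+1) : config k n.+1 :=
  [ffun r => [ffun x => w r (omap (fun i => i + s) x)]].

Lemma rotate_configK k n (s : 'I_n.+1) :
  cancel (@rotate_config k n s) (rotate_config (- s)).
Proof.
move=> w; apply/ffunP => r; apply/ffunP => -[i|]; rewrite !ffunE //=.
by rewrite addrNK.
Qed.

Lemma rotate_configs k n (s : 'I_n.+1) (P : pred 'I_k) c (w : config k n.+1) :
  w \in configs P c -> rotate_config s w \in configs P c.
Proof.
move=> /configsP h; apply/configsP => r; have [hN hS] := h r.
split; first by rewrite !ffunE.
rewrite -hS [RHS](reindex_inj (h := omap (fun i => i + s))).
  by apply: eq_bigr => x _; rewrite !ffunE.
by move=> [x|] [y|] //= /Some_inj /addIr ->.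
Qed.

(** Double counting of the pairs of a rotation and a configuration that it makes ballot; each
    rotation permutes the configurations. *)
Lemma card_ballot_configs k n (P : pred 'I_k) c : (\sum_r c r = n.+1)%N ->
  (n.+1 * #|[set w in configs (n := n.+1) P c | ballot w]|
   = \sum_(w in configs (n := n.+1) P c) \sum_r w r None)%N.
Proof.
move=> hc; rewrite -sum1dep_card big_mkcondr /=.
rewrite -[X in (X * _)%N]card_ord -sum_nat_const.
transitivity (\sum_(s : 'I_n.+1) \sum_(w in configs (n := n.+1) P c)
                 ballot (rotate_config s w))%N.
  apply: eq_bigr => s _.
  rewrite (reindex_inj (can_inj (rotate_configK s))) /=.
  apply: eq_big => [w|w _]; last by case: ballot.
  apply/idP/idP => [/(rotate_configs (- s))|/rotate_configs -> //].
  by rewrite rotate_configK.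
rewrite exchange_big; apply: eq_bigr => w /configsP hw.
(* The cycle lemma is applied to the column totals; the content of [None] is what they lack to reach
   [n.+1]. *)
rewrite -[RHS](@cycle_lemma n (fun i => \sum_r w r (Some i))%N) /=.
  apply: eq_bigr => s _; congr nat_of_bool; apply: eq_forallb => m.
  by congr leq; apply: eq_bigr => i _; apply: eq_bigr => r _; rewrite !ffunE.
rewrite exchange_big -big_split /=; apply: etrans hc; apply: eq_bigr => r _.
by have [_ <-] := hw r; rewrite sum_option addnC.
Qed.

Definition swap_slot k n (r0 : 'I_k) (x : option 'I_n) (w : config k n) :
    config k n :=
  [ffun r => if r == r0 then [ffun y => w r (tperm None x y)] else w r].

Lemma swap_slotK k n (r0 : 'I_k) (x : option 'I_n) :
  involutive (swap_slot r0 x).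
Proof.
move=> w; apply/ffunP => r; rewrite !ffunE; case: eqP => // _.
by apply/ffunP => y; rewrite !ffunE tpermK.
Qed.

Lemma swap_slot_configs k n (r0 : 'I_k) (x : option 'I_n)
    (P : pred 'I_k) c w :
  P r0 -> w \in configs P c -> swap_slot r0 x w \in configs P c.
Proof.
move=> Pr0 /configsP h; apply/configsP => r; have [hN hS] := h r.
rewrite ffunE; case: (r =P r0) => [er|//]; rewrite er Pr0; split=> //.
rewrite -er -hS [RHS](reindex_inj (@perm_inj _ (tperm None x))) /=.
by apply: eq_bigr => y _; rewrite ffunE.
Qed.

Lemma sum_last_slot k n (P : pred 'I_k) c :
  (n.+1 * \sum_(w in configs (n := n) P c) \sum_r w r None
   = (\sum_(r | P r) c r) * #|configs (n := n) P c|)%N.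
Proof.
rewrite exchange_big /= (bigID P) /= [X in (_ * (_ + X))%N]big1 => [|r Pr]; last first.
  by apply: big1 => w /configsP/(_ r)[]; rewrite (negPf Pr) /= => /eqP ->.
rewrite addn0 big_distrr big_distrl; apply: eq_bigr => r Pr /=.
rewrite [RHS]mulnC -[RHS]sum_nat_const.
transitivity (\sum_(w in configs (n := n) P c) \sum_x w r x)%N; last first.
  by apply: eq_bigr => w /configsP/(_ r)[_ ->].
(* One copy of the sum per slot: swapping [None] with [x] turns the content of [None] into that of
   [x], and row [r] adds up to [c r]. *)
transitivity (#|{: option 'I_n}|
              * \sum_(w in configs (n := n) P c) w r None)%N.
  by rewrite card_option card_ord.
rewrite exchange_big -sum_nat_const; apply: eq_bigr => x _ /=.
rewrite (reindex_inj (inv_inj (swap_slotK r x))) /=; apply: eq_big => w.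
  by apply/idP/idP => /(swap_slot_configs x Pr); rewrite ?swap_slotK.
by move=> _; rewrite !ffunE eqxx ffunE tpermL.
Qed.

(** * Words of steps as sequences of down-step counts *)

(* The number of [false]s of [s] preceded by exactly [u] [true]s. *)
Fixpoint falses_after (s : seq bool) (u : nat) : nat :=
  match s with
  | [::] => 0
  | true :: s' => if u is u'.+1 then falses_after s' u' else 0
  | false :: s' => (u == 0) + falses_after s' u
  end.

(** Inverse of [falses_after]: the values [d 0, ..., d N] determine a word with [N] up-steps. *)
Fixpoint word_of (N : nat) (d : nat -> nat) : seq bool :=
  nseq (d 0%N) false ++
  (if N is N'.+1 then true :: word_of N' (d \o succn) else [::]).

Lemma falses_after_nseq m s u :
  falses_after (nseq m false ++ s) u = ((u == 0) * m + falses_after s u)%N.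
Proof. by elim: m => [|m IH] /=; rewrite ?muln0 // IH; lia. Qed.

Lemma falses_after_word_of N d u :
  falses_after (word_of N d) u = if (u <= N)%N then d u else 0%N.
Proof.
elim: N d u => [|N IH] d u /=; rewrite falses_after_nseq /=.
  by case: u => [|u] /=; lia.
by case: u => [|u] /=; [lia | rewrite IH ltnS].
Qed.

Lemma count_true_word_of N d : count_mem true (word_of N d) = N.
Proof.
elim: N d => [|N IH] d /=; rewrite count_cat count_nseq /= ?IH; lia.
Qed.

Lemma count_false_word_of N d :
  count_mem false (word_of N d) = (\sum_(u < N.+1) d u)%N.
Proof.
elim: N d => [|N IH] d /=; rewrite count_cat count_nseq /= ?IH.
  by rewrite big_ord1 mul1n !addn0.
by rewrite [RHS]big_ord_recl mul1n add0n.
Qed.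

Lemma eq_word_of N d d' : (forall u, u <= N -> d u = d' u)%N ->
  word_of N d = word_of N d'.
Proof.
elim: N d d' => [|N IH] d d' h /=; rewrite h //.
by congr (_ ++ _ :: _); apply: IH => u hu; apply: h.
Qed.

Lemma word_ofK s : word_of (count_mem true s) (falses_after s) = s.
Proof.
elim: s => [//|[] s IH] /=; rewrite ?add1n ?add0n /=.
  by congr cons; rewrite -[RHS]IH; apply: eq_word_of.
by rewrite -[in RHS]IH; case: (count_mem true s).
Qed.

Lemma sum_falses_after s :
  (\sum_(u < (count_mem true s).+1) falses_after s u = count_mem false s)%N.
Proof. by rewrite -count_false_word_of word_ofK. Qed.

(** * Heights in terms of these counts *)

Lemma height_cons k b s j : height k (b :: s) j.+1 = rise k b + height k s j.
Proof. by rewrite /height /= big_cons. Qed.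

Lemma height0 k s : height k s 0 = 0.
Proof. by rewrite /height take0 big_nil. Qed.

Lemma height_size k s :
  height k s (size s) = (count_mem true s)%:Z - (k * count_mem false s)%N%:Z.
Proof.
elim: s => [|b s IH] /=; first by rewrite height0 muln0.
by rewrite height_cons IH; case: b => /=; lia.
Qed.

(** Among the vertices preceded by [u] up-steps the last one is the lowest, so it alone needs
    testing. The level [t] is an integer because the induction shifts it by the rise of the first
    step, possibly below zero. *)
Lemma height_geP k s (t : int) :
  (forall j, (j <= size s)%N -> - t <= height k s j) <->
  (forall u, (u <= count_mem true s)%N ->
     (k * \sum_(v < u.+1) falses_after s v)%N%:Z <= u%:Z + t).
Proof.
elim: s t => [|b s IH] t /=.
  split=> h.
    by move=> [|u] // _; rewrite big_ord1 muln0; have := h 0%N isT; rewrite height0; lia.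
  move=> [|j] // _; rewrite height0; have := h 0%N isT.
  by rewrite big_ord1 muln0; lia.
have E : (forall j, (j <= (size s).+1)%N -> - t <= height k (b :: s) j) <->
   (0 <= t) /\ (forall j, (j <= size s)%N -> - (t + rise k b) <= height k s j).
  split=> [h|[h0 h] [|j] hj].
  - split=> [|j hj]; first by have := h 0%N isT; rewrite height0; lia.
    by have := h j.+1 hj; rewrite height_cons; lia.
  - by rewrite height0; lia.
  - by rewrite height_cons; have := h j hj; lia.
rewrite E IH; case: b {E} => /=; rewrite ?add1n ?add0n.
  pose d v := if v is v'.+1 then falses_after s v' else 0%N.
  have S u : (\sum_(v < u.+2) d v = \sum_(v < u.+1) falses_after s v)%N.
    by rewrite big_ord_recl.
  split=> [[h0 h] [|u] hu|h].
  - by rewrite big_ord1 muln0; lia.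
  - by rewrite S (le_trans (h u hu)) //; lia.
  - split=> [|u hu]; first by have := h 0%N isT; rewrite big_ord1 muln0; lia.
    by have := h u.+1 hu; rewrite S => /le_trans -> //; lia.
have S u : (\sum_(v < u.+1) ((v == 0 :> nat) + falses_after s v)
            = 1 + \sum_(v < u.+1) falses_after s v)%N.
  by rewrite big_split /= big_ord_recl big1.
split=> [[h0 h] u hu|h]; first by rewrite S mulnDr muln1 PoszD -lerBrDl (le_trans (h u hu)) //; lia.
split=> [|u hu]; last first.
  by have := h u hu; rewrite S mulnDr muln1 PoszD -lerBrDl => /le_trans -> //; lia.
by have := h 0%N isT; lia.
Qed.

(** A down-step keeps the ordinate modulo [k], so it ends in the class of the starting ordinate plus
    the number of preceding up-steps. The start [c] is kept general for the induction. *)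
Lemma sum_down_steps k s (c i : int) :
  (\sum_(j < size s) (~~ nth true s j && (c + height k s j.+1 == i %[mod k])%Z)
   = \sum_(u < (count_mem true s).+1 | (c + u%:Z == i %[mod k])%Z)
       falses_after s u)%N.
Proof.
elim: s c => [|b s IH] c /=; first by rewrite big_ord0 big1.
rewrite big_ord_recl /=; under eq_bigr => j _ do rewrite height_cons addrA.
rewrite IH height_cons height0 addr0; case: b => /=.
  rewrite [RHS]big_mkcond [RHS]big_ord_recl /= if_same add0n -big_mkcond /=.
  by apply: eq_bigl => u; rewrite -addrA -intS.
rewrite -[RHS]/(\sum_(u < (count_mem true s).+1 | (c + u%:Z == i %[mod k])%Z)
                  ((u == 0 :> nat) + falses_after s u))%N.
have M x : (x - k%:Z == i %[mod k])%Z = (x == i %[mod k])%Z.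
  by rewrite -[in LHS](modzDr _ k) subrK.
rewrite big_split /=; congr addn.
  rewrite M big_mkcond big_ord_recl addr0 /= big1 ?addn0; first by case: ifP.
  by move=> u _; rewrite if_same.
by apply: eq_bigl => u; rewrite addrAC M.
Qed.

(** * From counts to configurations *)

Lemma sum_blocks k m (F : nat -> nat) :
  (\sum_(v < k * m) F v = \sum_(q < m) \sum_(r < k) F (k * q + r))%N.
Proof.
elim: m => [|m IH]; first by rewrite muln0 !big_ord0.
by rewrite mulnSr big_split_ord IH [RHS]big_ord_recr.
Qed.

Lemma sum_residue k m (F : nat -> nat) (r : 'I_k) :
  (\sum_(v < k * m | v %% k == r) F v = \sum_(q < m) F (k * q + r))%N.
Proof.
rewrite big_mkcond (sum_blocks _ _ (fun v => if v %% k == r then F v else 0))%N.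
apply: eq_bigr => q _; rewrite -big_mkcond /= (big_pred1 r) // => i.
by rewrite mulnC modnMDl modn_small.
Qed.

Definition slot_rank n (x : option 'I_n) : nat := oapp val n x.

Lemma sum_slots n (F : nat -> nat) :
  (\sum_(x : option 'I_n) F (slot_rank x) = \sum_(q < n.+1) F q)%N.
Proof. by rewrite sum_option big_ord_recr addnC.
Qed.

(** The change of variable [v = u + t]; slots and rows are then the quotients and remainders of [v]
    by [k]. *)
Definition delay (t : nat) (d : nat -> nat) (v : nat) : nat :=
  if (t <= v)%N then d (v - t)%N else 0%N.

Lemma sum_delay t d m (Q : pred nat) :
  (\sum_(v < t + m | Q v) delay t d v = \sum_(u < m | Q (t + u)) d u)%N.
Proof.
rewrite big_split_ord /= big1 ?add0n => [|v _].
  by apply: eq_bigr => u _; rewrite /delay leq_addr addKn.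
by rewrite /delay leqNgt ltn_ord.
Qed.

(** [inord] is faithful here as soon as all values of [d] are at most [n]. *)
Definition config_of (k t n : nat) (d : nat -> nat) : config k n :=
  [ffun r : 'I_k => [ffun x => inord (delay t d (k * slot_rank x + r))]].

Lemma config_ofE k t n d r x : (forall u, d u <= n)%N ->
  config_of k t n d r x = delay t d (k * slot_rank x + r) :> nat.
Proof.
by move=> hd; rewrite !ffunE inordK // /delay ltnS; case: ifP.
Qed.

Lemma sum_config_row k t n d (r : 'I_k) : (forall u, d u <= n)%N ->
  (t < k)%N -> (forall u, k * n < u -> d u = 0)%N ->
  (\sum_x config_of k t n d r x
   = \sum_(u < (k * n).+1 | (t + u) %% k == r) d u)%N.
Proof.
move=> hd htk d0.
under eq_bigr => x _ do rewrite config_ofE //.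
rewrite (sum_slots n (fun q => delay t d (k * q + r))) -sum_residue.
(* The [n.+1] slots cover [t] empty positions, those of [u <= k * n], and [k - t.+1] further ones
   where [d] vanishes. *)
have -> : (k * n.+1 = t + ((k * n).+1 + (k - t.+1)))%N by lia.
rewrite (sum_delay t d _ (fun v => v %% k == r)%N) big_split_ord /=.
by rewrite [X in (_ + X)%N]big1 ?addn0 // => u _; rewrite d0 //; lia.
Qed.

Lemma ballot_config_of k t n d : (forall u, d u <= n)%N -> (t < k)%N ->
  ballot (config_of k t n d)
  = [forall m : 'I_n, (\sum_(u < k * m.+1 - t) d u <= m)%N].
Proof.
move=> hd htk; apply: eq_forallb => m; congr leq.
have -> : (\sum_(i < n | i <= m) \sum_r config_of k t n d r (Some i)
  = \sum_(i < m.+1) \sum_(r < k) delay t d (k * i + r))%N.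
  rewrite (big_ord_widen n (fun i => \sum_(r < k) delay t d (k * i + r))%N) //.
  apply: eq_big => [i|i _]; first by rewrite ltnS.
  by apply: eq_bigr => r _; rewrite config_ofE.
rewrite -sum_blocks.
by rewrite -(sum_delay t d _ predT) subnKC //; nia.
Qed.

Lemma leq_sum_prefix (d : nat -> nat) x y : (x <= y)%N ->
  (\sum_(u < x) d u <= \sum_(u < y) d u)%N.
Proof. by move=> /subnKC <-; rewrite big_split_ord leq_addr. Qed.

(** The prefix sum is bounded by the quotient of [u + t] by [k]. Prefix sums do not decrease, so
    among the [u] of equal quotient [m] only the last, [k * m.+1 - t.+1], matters; a quotient of at
    least [n] gives no constraint, the total being [n]. *)
Lemma ballot_bounds k t n (d : nat -> nat) : (t < k)%N ->
  (\sum_(u < (k * n).+1) d u = n)%N ->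
  (forall u, (u <= k * n)%N -> (k * \sum_(v < u.+1) d v <= u + t)%N) <->
  [forall m : 'I_n, (\sum_(u < k * m.+1 - t) d u <= m)%N].
Proof.
move=> htk dn; split=> [h|/forallP h u hu].
  apply/forallP => m; have hm := ltn_ord m.
  have E : (k * m.+1 - t = (k * m.+1 - t.+1).+1)%N by nia.
  rewrite E; have := h (k * m.+1 - t.+1)%N.
  set S := (\sum_(_ < _) _)%N => hS; rewrite -ltnS -(ltn_pmul2l (m := k)); last by lia.
  by have hS' := hS ltac:(nia); nia.
have ut := divn_eq (u + t) k.
have um : ((u + t) %% k < k)%N by apply: ltn_pmod; lia.
suff hS : (\sum_(v < u.+1) d v <= (u + t) %/ k)%N.
  by rewrite [leqRHS]ut mulnC (leq_trans (leq_mul hS (leqnn k))) ?leq_addr.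
have [hq|hq] := ltnP ((u + t) %/ k) n.
  by apply: leq_trans (h (Ordinal hq)); apply: leq_sum_prefix => /=; nia.
by rewrite (leq_trans _ hq) // -[leqRHS]dn leq_sum_prefix.
Qed.

(** * The bijection between paths and ballot configurations *)

Lemma falses_after_le s u : (falses_after s u <= count_mem false s)%N.
Proof. by elim: s u => [|[] s IH] [|u] //=; rewrite ?add0n ?IH //= ?leq_add2l // ltnW // ltnS. Qed.

Lemma falses_after_gt s u : (count_mem true s < u)%N -> falses_after s u = 0%N.
Proof. by move=> h; rewrite -[s]word_ofK falses_after_word_of leqNgt h. Qed.

(* With [u] up-steps before it, a down-step ends at an ordinate congruent to [u]
   modulo [k]; [r] is the residue of [u + t]. *)
Definition class_of_residue (k t r : nat) : nat :=
  if (r <= t)%N then (r + (k - t))%N else (r - t)%N.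

Lemma class_of_residueE k t u (r : 'I_k) : (t < k)%N ->
  (u%:Z == (class_of_residue k t r)%:Z %[mod k])%Z = ((t + u) %% k == r)%N.
Proof.
move=> htk; rewrite -[in RHS](modn_small (ltn_ord r)) !modz_nat eqz_nat.
rewrite -(eqn_modDl t) /class_of_residue; case: ifP => hr.
  by rewrite (_ : t + (r + (k - t)) = r + k)%N ?modnDr //; lia.
by rewrite (_ : t + (r - t) = r)%N //; lia.
Qed.

Lemma card_down_steps k n (p : (k.+1 * n).-tuple bool) i :
  #|down_steps_at p i|
  = (\sum_(u < (count_mem true p).+1 | (u%:Z == i%:Z %[mod k])%Z)
       falses_after p u)%N.
Proof.
have := sum_down_steps k p 0 i; rewrite size_tuple.
under eq_bigr => j _ do rewrite add0r.
under [in RHS]eq_bigl => u do rewrite add0r.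
move=> <-; rewrite -sum1_card big_mkcond; apply: eq_bigr => j _.
by rewrite inE (tnth_nth true).
Qed.

Lemma mem_kt_dyck_paths k t n a (p : (k.+1 * n).-tuple bool) : (t < k)%N ->
  let w := config_of k t n (falses_after p) in
  (p \in kt_dyck_paths k t n a) =
  [&& count_mem false p == n, count_mem true p == (k * n)%N,
      w \in configs (fun r => r <= t)%N (fun r => a (class_of_residue k t r))
    & ballot w].
Proof.
move=> htk w; rewrite inE /kt_dyck -!andbA.
case: eqP => //= pf; case: eqP => //= pt.
have dn u : (falses_after p u <= n)%N.
  exact: leq_trans (falses_after_le p u) (eq_leq pf).
have d0 u : (k * n < u)%N -> falses_after p u = 0%N.
  by rewrite -pt => /falses_after_gt.
have -> : height k p (k.+1 * n) = 0.
  by have := height_size k p; rewrite size_tuple pf pt subrr.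
have sumd : (\sum_(u < (k * n).+1) falses_after p u = n)%N.
  by rewrite -pt sum_falses_after.
rewrite eqxx /= andbC; congr andb.
  apply/forallP/configsP => h.
    move=> r; split.
      (* In a row [r > t] the slot [n] stands for [u = k * n + r - t], more than the number of
         up-steps. *)
      have [//|hr] := leqP r t; rewrite -val_eqE /= config_ofE // /delay /=.
      by rewrite d0 ?if_same //; lia.
    have hi : ((class_of_residue k t r).-1 < k)%N.
      by rewrite /class_of_residue; have := ltn_ord r; case: ifP; lia.
    have := h (Ordinal hi) => /eqP /=; rewrite prednK; last first.
      by rewrite /class_of_residue; case: ifP; lia.
    move=> <-; rewrite card_down_steps pt sum_config_row //.
    by apply: eq_bigl => u; rewrite class_of_residueE.
  (* The class [i.+1] comes from the row of residue [(t + i.+1) %% k], with or without a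
     wrap-around. *)
  move=> i; have hr : ((t + i.+1) %% k < k)%N by apply: ltn_pmod; lia.
  have [_] := h (Ordinal hr); rewrite sum_config_row //=.
  have hc : class_of_residue k t ((t + i.+1) %% k) = i.+1.
    rewrite /class_of_residue; have hi := ltn_ord i.
    have [hk|hk] := ltnP (t + i.+1) k; first by rewrite modn_small //; case: ifP; lia.
    by rewrite -(subnK hk) modnDr modn_small; [case: ifP | ]; lia.
  rewrite hc => <-; rewrite card_down_steps pt; apply/eqP; apply: eq_bigl => u.
  by rewrite -[in LHS]hc (class_of_residueE _ (Ordinal hr)).
rewrite ballot_config_of //; apply/idP/idP.
  move=> /forallP h; apply/(ballot_bounds htk sumd) => u hu.
  have := (height_geP k p t%:Z).1; rewrite pt => H; have := H _ u hu.
  rewrite -PoszD lez_nat; apply=> j hj.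
  have hj' : (j < (k.+1 * n).+1)%N by have := hj; rewrite size_tuple.
  exact: h (Ordinal hj').
move=> /(ballot_bounds htk sumd) h; apply/forallP => j.
apply: (height_geP k p t%:Z).2; last by rewrite size_tuple -ltnS.
by move=> u; rewrite pt => /h; rewrite -PoszD lez_nat.
Qed.

(** [insub] sends every quotient from [n] on to [None]. *)
Definition lookup k n (hk : (0 < k)%N) (w : config k n) (v : nat) : nat :=
  w (Ordinal (ltn_pmod v hk)) (insub (v %/ k)%N).

Lemma lookup_config_of k t n (hk : (0 < k)%N) d u : (forall u, d u <= n)%N ->
  (t < k)%N -> (u <= k * n)%N -> lookup hk (config_of k t n d) (u + t) = d u.
Proof.
move=> hd htk hu; rewrite /lookup config_ofE //=.
have -> : slot_rank (insub ((u + t) %/ k)%N : option 'I_n) = ((u + t) %/ k)%N.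
  case: insubP => [y _ //|] /=; rewrite -leqNgt => hn; apply/eqP.
  by rewrite eqn_leq hn -ltnS ltn_divLR //; nia.
by rewrite mulnC -divn_eq /delay leq_addl addnK.
Qed.

Lemma lookupE k n (hk : (0 < k)%N) (w : config k n) (r : 'I_k) x :
  lookup hk w (k * slot_rank x + r) = w r x.
Proof.
rewrite /lookup; congr (nat_of_ord (w _ _)).
  by apply: val_inj; rewrite /= mulnC modnMDl modn_small.
rewrite mulnC divnMDl // divn_small // addn0.
by case: x => [y|] /=; [rewrite valK | rewrite insubN // ltnn].
Qed.

(** Two kinds of entries correspond to no [u <= k * n], and both are zero: those with [v < t] lie in
    the slot 0, which the ballot condition at [m = 0] empties, and those with [v > k * n + t] lie in
    the slot [n] of a row [r > t]. *)
Lemma config_of_lookup k t n (hk : (0 < k)%N) c (w : config k n) :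
  (0 < n)%N -> (t < k)%N -> w \in configs (fun r => r <= t)%N c -> ballot w ->
  config_of k t n
    (fun u => if (u <= k * n)%N then lookup hk w (u + t) else 0%N) = w.
Proof.
move=> hn htk /configsP hw /forallP hb; apply/ffunP => r; apply/ffunP => x.
rewrite !ffunE -[RHS]inord_val; congr inord; rewrite /delay.
case: (leqP t) => [tv|vt].
  case: leqP => [_|vk]; first by rewrite subnK // lookupE.
  have [] := hw r; case: x tv vk => [y|] /= tv vk.
    by have := ltn_ord y; have := ltn_ord r; nia.
  by case: leqP => [|_ /eqP -> //]; lia.
case: x vt => [y|] /= vt; last by nia.
have := hb (Ordinal hn); rewrite leqn0 => /eqP/eqP; rewrite sum_nat_eq0.
have y0 : (y <= 0)%N by nia.
move=> /forallP/(_ y); rewrite y0 /= sum_nat_eq0 => /forallP/(_ r) /= /eqP.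
by move=> ->.
Qed.

Lemma card_kt_dyck_paths k t n a : (t < k)%N -> (0 < n)%N ->
  (\sum_(r < k) a (class_of_residue k t r) = n)%N ->
  #|kt_dyck_paths k t n a|
  = #|[set w in configs (n := n) (fun r : 'I_k => r <= t)%N
                  (fun r => a (class_of_residue k t r)) | ballot w]|.
Proof.
move=> htk hn ha; have hk : (0 < k)%N by lia.
pose f (p : (k.+1 * n).-tuple bool) := config_of k t n (falses_after p).
(* Injectivity: a path is rebuilt from its counts, which [lookup] recovers from the
   configuration. *)
rewrite -(card_in_imset (f := f)); last first.
  move=> p q; rewrite !mem_kt_dyck_paths // => /and4P[/eqP pf /eqP pt _ _].
  move=> /and4P[/eqP qf /eqP qt _ _] fpq; apply: val_inj => /=.
  rewrite -[val p]word_ofK -[val q]word_ofK pt qt; apply: eq_word_of => u hu.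
  rewrite -(lookup_config_of (t := t) hk (d := falses_after p) (n := n)) //.
    rewrite -/(f p) fpq lookup_config_of // => v.
    exact: leq_trans (falses_after_le q v) (eq_leq qf).
  by move=> v; apply: leq_trans (falses_after_le p v) (eq_leq pf).
apply: eq_card => w; rewrite [RHS]inE; apply/imsetP/andP.
  case=> p; rewrite mem_kt_dyck_paths // => /and4P[_ _ h1 h2] ->.
  by split.
case=> hw hb; pose d u := if (u <= k * n)%N then lookup hk w (u + t) else 0%N.
have dE : config_of k t n d = w := config_of_lookup hk hn htk hw hb.
pose s := word_of (k * n) d.
have fs u : falses_after s u = d u.
  by rewrite falses_after_word_of /d; case: (u <= k * n)%N.
have dn u : (d u <= n)%N.
  by rewrite /d; case: ifP => // _; rewrite -ltnS ltn_ord.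
have st : count_mem true s = (k * n)%N := count_true_word_of _ _.
have sf : count_mem false s = n.
  rewrite count_false_word_of -[RHS]ha.
  (* Sorting the down-steps by residue makes their number the sum of the row totals. *)
  transitivity (\sum_(r < k) \sum_(u < (k * n).+1 | (t + u) %% k == r) d u)%N.
    rewrite (exchange_big_dep predT) //=; apply: eq_bigr => u _.
    by rewrite (big_pred1 (Ordinal (ltn_pmod (t + u) hk))).
  apply: eq_bigr => r _; have /configsP/(_ r)[_ <-] := hw; rewrite -dE.
  by rewrite sum_config_row // => u; rewrite /d ltnNge => /negPf ->.
have hs : size s == (k.+1 * n)%N.
  have -> : size s = (count_mem true s + count_mem false s)%N.
    by rewrite -(count_predC (pred1 true)); congr addn; apply: eq_count => -[].
  by rewrite st sf; lia.
have fw : f (Tuple hs) = w.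
  by rewrite -[RHS]dE; apply/ffunP => r; apply/ffunP => x; rewrite !ffunE /delay fs.
exists (Tuple hs) => //; rewrite mem_kt_dyck_paths // -/(f _) fw hw hb /= st sf.
by rewrite !eqxx.
Qed.

Theorem theorem2p3 (k t n : nat) (a : nat -> nat)
    (htk : (t < k)%N) (hn : (1 <= n)%N)
    (ha : (\sum_(1 <= i < k.+1) a i)%N = n) :
  (#|kt_dyck_paths k t n a|%:R : rat) =
    (\sum_(k - t <= i < k.+1) a i)%N%:R / (n%:R * (n.+1)%:R)
    * \prod_(k - t <= i < k.+1) ('C(n + a i, a i))%:R
    * \prod_(1 <= i < k - t) ('C(n + a i - 1, a i))%:R.
Proof.
pose c r := a (class_of_residue k t r).
(* Rows [r <= t] carry the classes [k - t, ..., k], the others [1, ..., k - t - 1]. An arbitrary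
   commutative monoid serves sums and products alike. *)
have low (R : Type) (idx : R) (op : Monoid.com_law idx) (F : nat -> R) :
    \big[op/idx]_(r < k | (r <= t)%N) F (class_of_residue k t r)
    = \big[op/idx]_(k - t <= i < k.+1) F i.
  rewrite -{1}(add0n (k - t)%N) big_addn.
  have -> : (k.+1 - (k - t) = t.+1)%N by lia.
  rewrite big_mkord (big_ord_widen k (fun r => F (r + (k - t))%N)) //.
  apply: eq_big => [r|r hr]; first by rewrite ltnS.
  by rewrite /class_of_residue hr.
have high (R : Type) (idx : R) (op : Monoid.com_law idx) (F : nat -> R) :
    \big[op/idx]_(r < k | ~~ (r <= t)%N) F (class_of_residue k t r)
    = \big[op/idx]_(1 <= i < k - t) F i.
  transitivity (\big[op/idx]_(t.+1 <= r < k) F (class_of_residue k t r)).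
    by rewrite big_geq_mkord; apply: eq_bigl => r; rewrite -ltnNge.
  rewrite -[t.+1]add1n big_addn; apply: eq_big_nat => i hi.
  rewrite /class_of_residue ifF ?addnK //; lia.
have hc : (\sum_(r < k) c r = n)%N.
  rewrite -ha (bigID (fun r : 'I_k => (r <= t)%N)) /= low high addnC.
  by rewrite -big_cat_nat //; lia.
have cn r : (r < k)%N -> (c r <= n)%N.
  by move=> hr; rewrite -hc (bigD1 (Ordinal hr)) //= leq_addr.
rewrite (card_kt_dyck_paths htk hn hc).
set P := fun r : 'I_k => (r <= t)%N.
set B := #|_|.
have cardC : (#|configs (n := n) P c|
    = (\prod_(k - t <= i < k.+1) 'C(n + a i, a i))
      * \prod_(1 <= i < k - t) 'C(n + a i - 1, a i))%N.
  rewrite card_configs => [|r]; last exact: cn.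
  rewrite (bigID P) /= -low -high; congr muln.
    by apply: eq_bigr => r; rewrite /P => ->; rewrite addn1 addSn subn1.
  by apply: eq_bigr => r; rewrite /P => /negPf ->; rewrite addn0.
(* By the cycle lemma [n * B] is the total content of the last slot, whose multiple by [n.+1] is
   given by the exchange of slots. *)
have key : (n.+1 * (n * B)
    = (\sum_(k - t <= i < k.+1) a i) * #|configs (n := n) P c|)%N.
  rewrite -low -sum_last_slot; congr muln.
  by case: n hn hc @B {cn cardC ha} => // m _ hc; exact: card_ballot_configs.
have keyR : n.+1%:R * (n%:R * B%:R)
    = (\sum_(k - t <= i < k.+1) a i)%N%:R * #|configs (n := n) P c|%:R :> rat.
  by rewrite -!natrM key.
have n0 : n%:R != 0 :> rat by rewrite pnatr_eq0; lia.
have n1 : n.+1%:R != 0 :> rat by rewrite pnatr_eq0.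
rewrite -mulrA -!natr_prod -[X in _ = _ * X]natrM -cardC.
apply: (mulfI (mulf_neq0 n1 n0)); rewrite -[LHS]mulrA keyR.
by field; rewrite n0 nat1r n1.
Qed.
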